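(* Let $\mathbb{F}=\mathbb{R}$ or $\mathbb{F}=\mathbb{C}$, let $n,m,p,q\in\mathbb{N}^*$, $d\in\mathbb{N}$, and for $(i,j)\in\{1,\dots,p\}\times\{1,\dots,q\}$ let $n_{i,j},m_{i,j}\in\mathbb{N}^*$ and $g_{i,j}\in\mathbb{N}$ be such that $n_{i,j}=n_{i,k}$ for all $i,j,k$ and $\sum_{\alpha=1}^p n_{\alpha,k}=n$ for all $k$, and $m_{i,k}=m_{j,k}$ for all $i,j,k$ and $\sum_{\beta=1}^q m_{j,\beta}=m$ for all $j$. Let $$\mathfrak{F}:=\left(\mathbb{F}^{n_{1,1}\times m_{1,1}}\right)^{g_{1,1}+1}\times\cdots\times\left(\mathbb{F}^{n_{p,q}\times m_{p,q}}\right)^{g_{p,q}+1}.$$ Let $S\subseteq\mathfrak{F}$ be the set whose complement is $$S^c=\left\{P\in\mathfrak{F}\;\middle|\;\operatorname{rk}_{\mathbb{F}(x)}\widehat{P}(x)<d\right\}.$$ Then $S^c$ is a proper algebraic variety if, and only if, $d\leq\min\{n,m\}$. Hence $S$ is generic with respect to $\mathbb{V}=S^c$ if, and only if, $d\leq\min\{n,m\}$.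
   Context: $\mathbb{N}=\{0,1,2,\dots\}$, $\mathbb{N}^*=\{1,2,\dots\}$. For $P=\big((P^{1,1}_0,\dots,P^{1,1}_{g_{1,1}}),\dots,(P^{p,q}_0,\dots,P^{p,q}_{g_{p,q}})\big)\in\mathfrak{F}$ put $P^{i,j}(x):=\sum_{k=0}^{g_{i,j}}P^{i,j}_kx^k\in\mathbb{F}[x]^{n_{i,j}\times m_{i,j}}$ and let $\widehat{P}(x)=[P^{i,j}(x)]_{i=1,\dots,p;\,j=1,\dots,q}\in\mathbb{F}[x]^{n\times m}$ be the resulting block matrix. $\operatorname{rk}_{\mathbb{F}(x)}$ is the rank over the field of rational functions $\mathbb{F}(x)$. The space $\mathfrak{F}$ is identified with $\mathbb{F}^G$, $G=\sum_{i,j}n_{i,j}m_{i,j}(g_{i,j}+1)$, by listing all matrix entries. A set $\mathbb{V}\subseteq\mathbb{F}^G$ is an algebraic variety if it is the set of common zeros of finitely many polynomials in $\mathbb{F}[x_1,\dots,x_G]$; it is proper if $\mathbb{V}\neq\mathbb{F}^G$. A set $S\subseteq\mathbb{F}^G$ is generic if its complement $S^c$ is contained in some proper algebraic variety $\mathbb{V}$; it is then called generic with respect to $\mathbb{V}$. *)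

(* Defs.v *)
From HB Require Import structures.
From mathcomp Require Import all_boot all_order all_algebra fraction.
From mathcomp Require Import boolp classical_sets reals.
From mathcomp Require Import complex mpoly.

Set Implicit Arguments.
Unset Strict Implicit.
Unset Printing Implicit Defensive.

Import GRing.Theory.
Local Open Scope classical_set_scope.
Local Open Scope ring_scope.

(* The points of F^G are functions {ffun 'I_G -> F}, so that a polynomial
   f : {mpoly F[G]} is evaluated at x by f.@[x]. *)
Section AlgebraicVarieties.
Variables (F : fieldType) (G : nat).

Definition algebraic_variety (V : set {ffun 'I_G -> F}) : Prop :=
  exists s : seq {mpoly F[G]},
    V = [set x | forall f, f \in s -> f.@[x] = 0].

Definition proper_algebraic_variety (V : set {ffun 'I_G -> F}) : Prop :=
  algebraic_variety V /\ V <> setT.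

Definition generic_wrt (S V : set {ffun 'I_G -> F}) : Prop :=
  proper_algebraic_variety V /\ ~` S `<=` V.

End AlgebraicVarieties.

Section BlockCoefficients.
Variables (F : fieldType) (p q : nat).
Variables (nn mm g : 'I_p -> 'I_q -> nat).

Definition coef_space : Type :=
  forall (i : 'I_p) (j : 'I_q),
    {ffun 'I_(g i j).+1 -> 'M[F]_(nn i j, mm i j)}.

Definition coef_dim : nat :=
  (\sum_(i < p) \sum_(j < q) nn i j * mm i j * (g i j).+1)%N.

Definition block_index (ij : 'I_p * 'I_q) : finType :=
  ('I_(g ij.1 ij.2).+1 * ('I_(nn ij.1 ij.2) * 'I_(mm ij.1 ij.2)))%type.

(* A position ((i, j); (k, (r, c))) designates the entry (r, c) of P^{i,j}_k;
   the positions are enumerated in lexicographic order. *)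
Definition coef_index : finType := {ij : 'I_p * 'I_q & block_index ij}.

Lemma card_coef_index : #|coef_index| = coef_dim.
Proof.
rewrite card_tagged sumnE big_map big_enum /= /coef_dim pair_big /=.
by apply: eq_bigr => -[i j] _; rewrite !card_prod !card_ord mulnC.
Qed.

Definition coef_entry (P : coef_space) (t : coef_index) : F :=
  P (tag t).1 (tag t).2 (tagged t).1 (tagged t).2.1 (tagged t).2.2.

(* The identification of coef_space with F^G, G = coef_dim. *)
Definition coords (P : coef_space) : {ffun 'I_coef_dim -> F} :=
  [ffun l => coef_entry P (enum_val (cast_ord (esym card_coef_index) l))].

Lemma coords_bij : bijective coords.
Proof.
pose rk t : 'I_coef_dim := cast_ord card_coef_index (enum_rank t).
pose pos i j k r c : coef_index :=
  @Tagged _ (i, j) block_index (k, (r, c)).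
pose inv (x : {ffun 'I_coef_dim -> F}) : coef_space := fun i j =>
  [ffun k => \matrix_(r, c) x (rk (pos i j k r c))].
exists inv => [P|x].
  apply: functional_extensionality_dep => i.
  apply: functional_extensionality_dep => j.
  by apply/ffunP => k; apply/matrixP => r c;
     rewrite !ffunE !mxE ffunE cast_ordK enum_rankK.
apply/ffunP => l; rewrite ffunE.
set t := enum_val _; have -> : l = rk t by rewrite /rk enum_valK cast_ordKV.
by case: t => -[i j] [k [r c]]; rewrite /coef_entry /= ffunE mxE.
Qed.

Definition block_poly (P : coef_space) (i : 'I_p) (j : 'I_q) :
    'M[{poly F}]_(nn i j, mm i j) :=
  \sum_(k < (g i j).+1) 'X^k *: map_mx polyC (P i j k).

(* \mxblock wants the height of a block to depend on i only and its width on j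
   only, so the blocks are cast to the sizes read off along column j0 and row
   i0; the compatibility hypotheses make this choice immaterial. *)
Definition block_matrix (n m : nat)
    (hnn : forall i j k, nn i j = nn i k)
    (hn : forall k, (\sum_(a < p) nn a k)%N = n)
    (hmm : forall i j k, mm i k = mm j k)
    (hm : forall j, (\sum_(b < q) mm j b)%N = m)
    (i0 : 'I_p) (j0 : 'I_q) (P : coef_space) : 'M[{poly F}]_(n, m) :=
  castmx (hn j0, hm i0)
    (\mxblock_(i < p, j < q)
       castmx (hnn i j j0, hmm i i0 j) (block_poly P i j)).

End BlockCoefficients.

Definition rank_ratfun (F : fieldType) (n m : nat) (A : 'M[{poly F}]_(n, m)) :
    nat :=
  \rank (map_mx (@tofrac {poly F}) A).

(* Main.v *)
(** A matrix over F[x] has rank < d over F(x) iff all its d x d minors vanish.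
    For the block matrix of P, the coefficients of these minors are polynomials
    in the entries of P: they are read off the minors of a single generic matrix
    over F[X_1, ..., X_G][x] that specializes to every block matrix. So the rank
    condition always cuts out a variety. Every constant matrix is a block matrix,
    in particular one of rank min(n, m), so the variety is proper exactly when
    d <= min(n, m). *)

Require Import Defs.
From HB Require Import structures.
From mathcomp Require Import all_boot all_order all_algebra fraction.
From mathcomp Require Import boolp classical_sets reals.
From mathcomp Require Import complex mpoly.

Set Implicit Arguments.
Unset Strict Implicit.
Unset Printing Implicit Defensive.

Import GRing.Theory.
Local Open Scope classical_set_scope.
Local Open Scope ring_scope.

Lemma row_free_rowsub (K : fieldType) (m n d : nat) (f : 'I_d -> 'I_m)
    (A : 'M[K]_(m, n)) :
  injective f -> row_free A -> row_free (rowsub f A).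
Proof.
move=> injf /row_freeP[B AB1]; apply/row_freeP; exists (colsub f B).
by rewrite -mxsub_mul AB1; apply/matrixP => i j; rewrite !mxE (inj_eq injf).
Qed.

(** [maxrankfun] selects a maximal free family of rows; its first [d] members remain free. *)
Lemma exists_row_free_rowsub (K : fieldType) (m n d : nat) (A : 'M[K]_(m, n)) :
  (d <= \rank A)%N -> exists f : 'I_d -> 'I_m, row_free (rowsub f A).
Proof.
move=> le_d; exists (maxrankfun A \o widen_ord le_d).
have -> : rowsub (maxrankfun A \o widen_ord le_d) A =
    rowsub (widen_ord le_d) (rowsub (maxrankfun A) A).
  by apply/matrixP => i j; rewrite !mxE.
apply: row_free_rowsub (maxrowsub_free A) => i j /(congr1 val).
by move=> /= /val_inj.
Qed.

(** Pick [d] free rows, then [d] free columns among them by transposing; conversely a submatrix has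
    rank at most that of [A]. Injectivity of [f] and [h] need not be required, since a repeated
    index makes the determinant vanish. Finite functions let the minors be enumerated. *)
Lemma leq_rank_minorP (K : fieldType) (m n d : nat) (A : 'M[K]_(m, n)) :
  (d <= \rank A)%N <->
  exists (f : {ffun 'I_d -> 'I_m}) (h : {ffun 'I_d -> 'I_n}),
    \det (mxsub f h A) != 0.
Proof.
split=> [/exists_row_free_rowsub[f]|[f [h]]].
  rewrite /row_free -mxrank_tr => /eqP rkf.
  have /exists_row_free_rowsub[h] : (d <= \rank (rowsub f A)^T)%N by rewrite rkf.
  rewrite row_free_unit unitmxE unitfE => det_neq0.
  exists (finfun f), (finfun h); rewrite -det_tr; congr (\det _ != 0): det_neq0.
  by apply/matrixP => i j; rewrite !mxE !ffunE.
rewrite -unitfE -unitmxE -row_free_unit => /eqP <-.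
have -> : mxsub f h A = rowsub f (colsub h A).
  by apply/matrixP => i j; rewrite !mxE.
apply: leq_trans (mxrankS (rowsub_sub _ _)) _.
rewrite -mxrank_tr -[leqRHS]mxrank_tr.
have -> : (colsub h A)^T = rowsub h A^T by apply/matrixP => i j; rewrite !mxE.
exact: mxrankS (rowsub_sub _ _).
Qed.

(** Determinants commute with the injection [tofrac], so the minors over F(x) can be tested in
    F[x]. *)
Lemma ltn_rank_ratfunP (F : fieldType) (n m d : nat) (A : 'M[{poly F}]_(n, m)) :
  (rank_ratfun A < d)%N <->
  forall (f : {ffun 'I_d -> 'I_n}) (h : {ffun 'I_d -> 'I_m}),
    \det (mxsub f h A) = 0.
Proof.
have detE (f : {ffun 'I_d -> 'I_n}) (h : {ffun 'I_d -> 'I_m}) :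
    (\det (mxsub f h (map_mx (@tofrac {poly F}) A)) == 0) =
    (\det (mxsub f h A) == 0).
  by rewrite -map_mxsub det_map_mx tofrac_eq0.
split=> [lt_d f h|minor0].
  apply/eqP; rewrite -detE; apply/negPn/negP => nz.
  move: lt_d; rewrite ltnNge => /negP; apply.
  by apply/leq_rank_minorP; exists f, h.
rewrite ltnNge; apply/negP => /leq_rank_minorP[f [h]].
by rewrite detE minor0 eqxx.
Qed.

Lemma rank_ratfun_polyC (F : fieldType) (n m : nat) (A : 'M[F]_(n, m)) :
  rank_ratfun (map_mx polyC A) = \rank A.
Proof.
rewrite /rank_ratfun -map_mx_comp.
exact: (mxrank_map (@tofrac {poly F} \o @polyC F)).
Qed.

Section BlockMatrix.
Variables (F : fieldType) (p q n m : nat) (nn mm g : 'I_p -> 'I_q -> nat).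
Hypotheses (hnn : forall i j k, nn i j = nn i k)
           (hn : forall k, (\sum_(a < p) nn a k)%N = n)
           (hmm : forall i j k, mm i k = mm j k)
           (hm : forall j, (\sum_(b < q) mm j b)%N = m)
           (i0 : 'I_p) (j0 : 'I_q).

Local Notation G := (coef_dim nn mm g).
Local Notation Phat :=
  (block_matrix hnn hn hmm hm i0 j0 : coef_space F nn mm g -> _).

(** [A] does not depend on [P], so its finitely many minors give equations valid for all [P] at
    once. *)
Lemma block_matrix_generic :
  exists A : 'M[{poly {mpoly F[G]}}]_(n, m),
    forall P, map_mx (map_poly (meval (coords P))) A = Phat P.
Proof.
suff /fin_all_exists[A hA] : forall rc : 'I_n * 'I_m,
    exists a : {poly {mpoly F[G]}},
    forall P, map_poly (meval (coords P)) a = Phat P rc.1 rc.2.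
  exists (\matrix_(r, c) A (r, c)) => P; apply/matrixP => r c.
  by rewrite !mxE hA.
case=> r c /=.
set i := tagnat.sig1 (cast_ord (esym (hn j0)) r).
set j := tagnat.sig1 (cast_ord (esym (hm i0)) c).
(* [r'] and [c'] are the position inside block [(i, j)], with the casts of [block_matrix] undone. *)
pose r' := cast_ord (esym (hnn i j j0)) (tagnat.sig2 (cast_ord (esym (hn j0)) r)).
pose c' := cast_ord (esym (hmm i i0 j)) (tagnat.sig2 (cast_ord (esym (hm i0)) c)).
pose t k : coef_index nn mm g := @Tagged _ (i, j) (block_index nn mm g) (k, (r', c')).
pose v k : 'I_G := cast_ord (card_coef_index nn mm g) (enum_rank (t k)).
(* The coefficient of ['X^k] is the variable that [coords] assigns to entry [(r', c')] of
   [P i j k]. *)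
exists (\sum_(k < (g i j).+1) 'X^k * ('X_(v k))%:P) => P.
rewrite /block_matrix castmxE mxE castmxE /block_poly summxE rmorph_sum.
apply: eq_bigr => k _; rewrite rmorphM /= map_polyXn map_polyC /= mevalXU.
by rewrite !mxE ffunE cast_ordK enum_rankK.
Qed.

(** The blocks of [A] go into degree 0, which exists in every block as there are [(g i j).+1]
    coefficients. *)
Lemma block_matrix_const (A : 'M[F]_(n, m)) :
  exists P, Phat P = map_mx polyC A.
Proof.
pose B := castmx (esym (hn j0), esym (hm i0)) A.
exists (fun i j => [ffun k => if k == ord0 then
  castmx (esym (hnn i j j0), esym (hmm i i0 j)) (submxblock B i j) else 0]).
have -> : A = castmx (hn j0, hm i0) B by rewrite castmxKV.
rewrite /block_matrix map_castmx; congr castmx.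
rewrite -[RHS]submxblockK; apply: eq_mxblock => i j.
rewrite /block_poly big_ord_recl big1 => [|k _]; last first.
  by rewrite ffunE /= map_mx0 scaler0.
rewrite ffunE eqxx addr0 scale1r map_castmx castmxKV.
by rewrite [in LHS]/submxblock map_mxsub.
Qed.

Lemma algebraic_variety_rank (d : nat) :
  algebraic_variety
    (@coords F p q nn mm g @` [set P | (rank_ratfun (Phat P) < d)%N]).
Proof.
have [A hA] := block_matrix_generic.
pose minor (fh : {ffun 'I_d -> 'I_n} * {ffun 'I_d -> 'I_m}) :=
  \det (mxsub fh.1 fh.2 A).
have minorE P fh :
    map_poly (meval (coords P)) (minor fh) = \det (mxsub fh.1 fh.2 (Phat P)).
  by rewrite -hA -map_mxsub det_map_mx.
(* A polynomial coerces to its coefficient list: the equations are all coefficients of all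
   minors. *)
exists (flatten [seq (minor fh : seq _) |
  fh <- enum {: {ffun 'I_d -> 'I_n} * {ffun 'I_d -> 'I_m}}]).
apply/seteqP; split=> [_ [P /ltn_rank_ratfunP rkP <-] f|x /= x0].
  case/flatten_mapP=> fh _ /(nthP 0)[k _ <-].
  by rewrite -coef_map minorE rkP coef0.
have [inv _ invK] := @coords_bij F p q nn mm g.
exists (inv x) => //; apply/ltn_rank_ratfunP => f h.
rewrite -(minorE _ (f, h)) invK; apply/polyP => k; rewrite coef_map coef0.
(* Coefficients past the size are 0 by default and are not among the equations. *)
have [lek|ltk] := leqP (size (minor (f, h))) k.
  by rewrite nth_default //= raddf0.
by apply/x0/flatten_mapP; exists (f, h); rewrite ?mem_enum ?mem_nth.
Qed.

Lemma proper_rank_variety (d : nat) :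
  proper_algebraic_variety
    (@coords F p q nn mm g @` [set P | (rank_ratfun (Phat P) < d)%N])
  <-> (d <= minn n m)%N.
Proof.
have [inv coordsK invK] := @coords_bij F p q nn mm g.
split=> [[_ neqT]|le_d]; last split; first 1 last.
- exact: algebraic_variety_rank.
(* A constant matrix of the largest possible rank gives a point off the variety. *)
- move=> eqT; have [P PE] := block_matrix_const (pid_mx (minn n m)).
  have : [set: {ffun 'I_G -> F}] (coords P) by [].
  rewrite -eqT => -[Q + /(can_inj coordsK) QP] /=.
  rewrite QP /= PE rank_ratfun_polyC rank_pid_mx ?geq_minl ?geq_minr //.
  by rewrite ltnNge le_d.
- rewrite leqNgt; apply/negP => lt_d; apply: neqT.
  apply/seteqP; split=> // x _; exists (inv x) => //=.
  apply: leq_ltn_trans lt_d.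
  by rewrite leq_min rank_leq_row rank_leq_col.
Qed.

End BlockMatrix.

Theorem proposition3p9 (R : realType) (F : fieldType)
    (hF : F = R :> fieldType \/ F = R[i] :> fieldType)
    (n m p q d : nat)
    (n_gt0 : (0 < n)%N) (m_gt0 : (0 < m)%N)
    (p_gt0 : (0 < p)%N) (q_gt0 : (0 < q)%N)
    (nn mm g : 'I_p -> 'I_q -> nat)
    (nn_gt0 : forall i j, (0 < nn i j)%N)
    (mm_gt0 : forall i j, (0 < mm i j)%N)
    (hnn : forall i j k, nn i j = nn i k)
    (hn : forall k, (\sum_(a < p) nn a k)%N = n)
    (hmm : forall i j k, mm i k = mm j k)
    (hm : forall j, (\sum_(b < q) mm j b)%N = m)
    (S : set (coef_space F nn mm g))
    (hS : ~` S =
      [set P | (rank_ratfun (block_matrix hnn hn hmm hm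
                  (Ordinal p_gt0) (Ordinal q_gt0) P) < d)%N]) :
  (proper_algebraic_variety (@coords F p q nn mm g @` (~` S))
     <-> (d <= minn n m)%N) /\
  (generic_wrt (@coords F p q nn mm g @` S) (@coords F p q nn mm g @` (~` S))
     <-> (d <= minn n m)%N).
Proof.
rewrite hS; split; first exact: proper_rank_variety.
split=> [[/proper_rank_variety //]|le_d]; split; first exact/proper_rank_variety.
have [inv coordsK invK] := @coords_bij F p q nn mm g.
(* Surjectivity of [coords] turns a point outside the image of [S] into the image of a point outside
   [S]. *)
rewrite -hS => x /= nSx; exists (inv x) => // Sx.
by apply: nSx; exists (inv x).
Qed.
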